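(* Let $\mathbb{K}$ be an infinite field and let $T=\sum_{i=1}^r u_i \otimes v_i \otimes w_i\in\mathbb{K}^{m\times n\times p}$ where the vectors $u_1,\dots,u_r$ are linearly independent, the vectors $v_1,\dots,v_r$ are linearly independent, and every $w_i$ is nonzero. Let $T=\sum_{\ell =1}^q M_{\ell} \otimes \gamma_{\ell}$ and $T=\sum_{\ell =1}^{q'} M'_{\ell} \otimes \gamma'_{\ell}$ be two matrix-vector decompositions of $T$ of rank $r$. Then $q=q'$ and there is a permutation $\pi$ of $\{1,\dots,q\}$ such that $\operatorname{Im} M'_{\ell} = \operatorname{Im} M_{\pi(\ell)}$ for all $\ell$.
   Context: For $M\in M_{m,n}(\mathbb{K})$, $w\in\mathbb{K}^p$, $M\otimes w$ has entries $M_{ij}w_k$; $u\otimes v\otimes w$ has entries $u_iv_jw_k$. A matrix-vector decomposition of $T$ is an expression $T=\sum_{\ell} M_\ell\otimes \gamma_\ell$ with all $M_\ell$ nonzero, all $\gamma_\ell$ nonzero, and no two $\gamma_\ell$ colinear; its rank is $\sum_\ell\operatorname{rank}(M_\ell)$. *)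

(* Defs.v *)
From HB Require Import structures.
From mathcomp Require Import all_boot all_order all_fingroup all_algebra.
From mathcomp Require Import classical_sets cardinality.
Set Implicit Arguments.
Unset Strict Implicit.
Unset Printing Implicit Defensive.
Import GRing.Theory.
Local Open Scope ring_scope.

Notation tensor K m n p := {ffun 'I_m * 'I_n * 'I_p -> K}.

Definition tensor3 (K : fieldType) (m n p : nat)
    (u : 'cV[K]_m) (v : 'cV[K]_n) (w : 'cV[K]_p) : tensor K m n p :=
  [ffun t => u t.1.1 0 * v t.1.2 0 * w t.2 0].

Definition tensor_mv (K : fieldType) (m n p : nat)
    (M : 'M[K]_(m, n)) (w : 'cV[K]_p) : tensor K m n p :=
  [ffun t => M t.1.1 t.1.2 * w t.2 0].

Definition colinear (K : fieldType) (p : nat) (x y : 'cV[K]_p) : Prop :=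
  (exists c : K, x = c *: y) \/ (exists c : K, y = c *: x).

Definition mv_decomposition (K : fieldType) (m n p : nat) (T : tensor K m n p)
    (q : nat) (M : 'I_q -> 'M[K]_(m, n)) (gamma : 'I_q -> 'cV[K]_p) : Prop :=
  [/\ T = \sum_(l < q) tensor_mv (M l) (gamma l),
      forall l, M l != 0,
      forall l, gamma l != 0
    & forall l1 l2, l1 != l2 -> ~ colinear (gamma l1) (gamma l2)].

Definition mv_rank (K : fieldType) (m n q : nat)
    (M : 'I_q -> 'M[K]_(m, n)) : nat :=
  (\sum_(l < q) \rank (M l))%N.

(* The matrix library's own subspace operations are about row spaces; [Im M] is
   the image of the linear map x |-> M x on column vectors. *)
Definition Im (K : fieldType) (m n : nat) (M : 'M[K]_(m, n)) :
    {vspace 'cV[K]_m} :=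
  limg (linfun (mulmx M : 'cV[K]_n -> 'cV[K]_m)).

(* Main.v *)
Require Import Defs.
From HB Require Import structures.
From mathcomp Require Import all_boot all_order all_fingroup all_algebra.
From mathcomp Require Import classical_sets cardinality.
Set Implicit Arguments.
Unset Strict Implicit.
Unset Printing Implicit Defensive.
Import GRing.Theory.
Local Open Scope ring_scope.

(* Contracting the last index of T with a covector phi gives
   sum_l phi(gamma_l) M_l = U^T diag(phi(w_i)) V, where U and V have rows u_i
   and v_i. Since K is infinite, some phi0 has phi0(w_i) != 0 for all i; this
   contraction has rank r = sum_l rank M_l, so ranks add up. Hence
   M_l = U^T N_l V, and, after normalization by diag(phi0(w_i)), the N_l become
   orthogonal idempotents P_l with sum 1. By the identity for the other phi,
   every diagonal matrix diag(phi(w_i) / phi0(w_i)) acts on P_l as the scalar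
   phi(gamma_l) / phi0(gamma_l), so a nonzero entry of P_l in column i forces
   w_i to be colinear to gamma_l. Therefore Im M_l is the span of the u_i with
   w_i colinear to gamma_l: the images are determined by the partition of the
   w_i into colinearity classes, whatever the decomposition. *)

(** * Covectors that vanish on none of finitely many vectors *)

Lemma infinite_nonroot (K : fieldType) (P : {poly K}) :
  infinite_set [set: K]%classic -> P != 0 -> exists x, ~~ root P x.
Proof.
move=> K_inf P_neq0.
have seqs k : exists2 s : seq K, uniq s & size s = k.
  elim: k => [|k [s s_uniq size_s]]; first by exists [::].
  have [x x_notin] : exists x, x \notin s.
    apply: boolp.contrapT => s_full; apply: K_inf.
    apply: sub_finite_set (finite_seq s) => x _ /=.
    by apply/negPn/negP => x_notin; apply: s_full; exists x.
  by exists (x :: s) => /=; rewrite ?x_notin ?size_s.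
(* A nonzero [P] has fewer than [size P] distinct roots. *)
have [s s_uniq size_s] := seqs (size P).
have : ~~ all (root P) s.
  apply/negP => s_roots.
  by have := max_poly_roots P_neq0 s_roots s_uniq; rewrite size_s ltnn.
by case/allPn => x _ x_nonroot; exists x.
Qed.

(** Take [phi] on the moment curve, with entries [x ^+ k]: its value on [w i] is a nonzero
    polynomial evaluated at [x], and a non-root of the product of these polynomials serves every [i]
    at once. *)
Lemma separating_covector (K : fieldType) (p r : nat) (w : 'I_r -> 'cV[K]_p) :
  infinite_set [set: K]%classic -> (forall i, w i != 0) ->
  exists phi : 'rV[K]_p, forall i, (phi *m w i) 0 0 != 0.
Proof.
move=> K_inf w_neq0.
have [|x] := @infinite_nonroot K (\prod_i rVpoly (w i)^T) K_inf.
  apply/prodf_neq0 => i _; apply: contra (w_neq0 i) => /eqP w_i0.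
  by rewrite -[w i]trmxK -[(w i)^T]rVpolyK w_i0 !linear0.
rewrite rootE horner_prod => /prodf_neq0 x_nonroot.
exists (\row_k x ^+ k) => i; have := x_nonroot i isT.
rewrite horner_poly mxE; congr (_ != 0).
apply: eq_bigr => k _; rewrite valK !mxE mulrC; congr (_ * _).
Qed.

(** * Sums of matrices whose ranks add up *)

Section RankAdditivity.
Variables (K : fieldType) (q : nat).

Lemma mxrank_sum_le (m n : nat) (P : pred 'I_q) (B : 'I_q -> 'M[K]_(m, n)) :
  (\rank (\sum_(k | P k) B k)%R <= \sum_(k | P k) \rank (B k))%N.
Proof.
elim/big_ind2: _ => [|A a C c leA leC|//]; first by rewrite mxrank0.
exact: leq_trans (mxrank_add _ _) (leq_add leA leC).
Qed.

(** The row space of the sum lies in the sum of the row spaces, whose dimension is at most the sum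
    of the ranks; the hypothesis forces equality. *)
Lemma rank_additive_sub (m n : nat) (B : 'I_q -> 'M[K]_(m, n)) l :
  (\sum_k \rank (B k) <= \rank (\sum_k B k)%R)%N -> (B l <= (\sum_k B k)%R)%MS.
Proof.
move=> rankB.
have sub_gen : ((\sum_k B k)%R <= \sum_k <<B k>>)%MS.
  by apply: summx_sub_sums => k _; rewrite genmxE.
have sub_sum : (\sum_k <<B k>> <= (\sum_k B k)%R)%MS.
  rewrite -(geq_leqif (mxrank_leqif_sup sub_gen)) (leq_trans _ rankB) //.
  apply: leq_trans (mxrank_sum_leqif _) _ => /=.
  by apply: leq_sum => k _; rewrite genmxE.
by apply: submx_trans sub_sum; rewrite (sumsmx_sup l) // genmxE.
Qed.

(* Equality of ranks makes the row spaces of the [P l] independent, and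
   [P k *m P l - (k == l) *: P k] is a family in these row spaces summing to 0. *)
Lemma rank_additive_idem (r : nat) (P : 'I_q -> 'M[K]_r) k l :
  \sum_l P l = 1%:M -> (\sum_l \rank (P l) <= r)%N ->
  P k *m P l = if k == l then P k else 0.
Proof.
move=> sumP rankP.
have dirP : mxdirect (\sum_l P l)%MS.
  rewrite mxdirectE /= eqn_leq (mxrank_sum_leqif _) /= (leq_trans rankP) //.
  rewrite -{1}(mxrank1 K r) -sumP; apply: mxrankS.
  exact: summx_sub_sums.
pose X l := P k *m P l - (if k == l then P k else 0).
have sumX : \sum_j X j = 0.
  by rewrite sumrB -mulmx_sumr sumP mulmx1 -big_mkcond (big_pred1 k) ?subrr.
have subX j : (X j <= P j)%MS.
  rewrite addmx_sub ?submxMl // eqmx_opp.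
  by case: eqP => [<-|_]; rewrite ?submx_refl ?sub0mx.
have /mxdirect_sumsP/(_ l isT) cap0 := dirP.
apply/eqP; rewrite -subr_eq0 -/(X l) -submx0 -cap0 sub_capmx subX /=.
move: sumX; rewrite (bigD1 l) //= => /eqP; rewrite addr_eq0 => /eqP ->.
by rewrite eqmx_opp summx_sub_sums.
Qed.

(** With a zero coefficient at [l], the rank would be at most the sum of the other ranks, which is
    below [r]. *)
Lemma rank_additive_coef_neq0 (m n r : nat) (B : 'I_q -> 'M[K]_(m, n))
    (a : 'I_q -> K) l :
  \rank (\sum_k a k *: B k)%R = r -> (\sum_k \rank (B k) <= r)%N -> B l != 0 ->
  a l != 0.
Proof.
move=> rank_sum rankB; apply: contra => /eqP a_l0.
rewrite -mxrank_eq0 -leqn0 -(leq_add2r (\sum_(k | k != l) \rank (B k))) add0n.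
apply: leq_trans (_ : r <= _)%N; first by rewrite (bigD1 l) in rankB.
rewrite -rank_sum (bigD1 l) //= a_l0 scale0r add0r.
apply: leq_trans (mxrank_sum_le _ _) _.
by apply: leq_sum => k _; exact: mxrank_scale.
Qed.
End RankAdditivity.

(** * Contraction of the last index *)

Definition contract (K : fieldType) (m n p : nat) (phi : 'rV[K]_p)
    (T : tensor K m n p) : 'M[K]_(m, n) :=
  \matrix_(i, j) \sum_k phi 0 k * T (i, j, k).

Lemma contract_sum (K : fieldType) (m n p q : nat) (phi : 'rV[K]_p)
    (F : 'I_q -> tensor K m n p) :
  contract phi (\sum_l F l) = \sum_l contract phi (F l).
Proof.
apply/matrixP => i j; rewrite summxE mxE.
under [RHS]eq_bigr do rewrite mxE.
rewrite exchange_big; apply: eq_bigr => k _.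
by rewrite sum_ffunE mulr_sumr.
Qed.

Lemma contract_mv (K : fieldType) (m n p : nat) (phi : 'rV[K]_p)
    (M : 'M[K]_(m, n)) (gamma : 'cV[K]_p) :
  contract phi (tensor_mv M gamma) = (phi *m gamma) 0 0 *: M.
Proof.
apply/matrixP => i j; rewrite !mxE mulr_suml; apply: eq_bigr => k _.
by rewrite ffunE /= mulrCA mulrC.
Qed.

Lemma tensor3_mv (K : fieldType) (m n p : nat)
    (u : 'cV[K]_m) (v : 'cV[K]_n) (w : 'cV[K]_p) :
  tensor3 u v w = tensor_mv (u *m v^T) w.
Proof.
by apply/ffunP => t; rewrite !ffunE mxE big_ord1 !mxE.
Qed.

(** * The model case: the [u i] and [v i] are standard bases *)

Lemma diagonal_pencil (K : fieldType) (p q r : nat) (N : 'I_q -> 'M[K]_r)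
    (w : 'I_r -> 'cV[K]_p) (gamma : 'I_q -> 'cV[K]_p) (phi0 : 'rV[K]_p) :
    let a i := (phi0 *m w i) 0 0 in let b l := (phi0 *m gamma l) 0 0 in
    (forall phi : 'rV_p, \sum_l (phi *m gamma l) 0 0 *: N l =
      diag_mx (\row_i (phi *m w i) 0 0)) ->
    (\sum_l \rank (N l) <= r)%N ->
    (forall i, a i != 0) -> (forall l, b l != 0) ->
    (forall l1 l2, l1 != l2 -> ~ colinear (gamma l1) (gamma l2)) ->
  exists c : 'I_r -> 'I_q,
    (forall i, w i = (a i / b (c i)) *: gamma (c i)) /\
    (forall l, N l = diag_mx (\row_i (if c i == l then a i / b l else 0))).
Proof.
move=> a b pencil rankN a_neq0 b_neq0 gamma_nc.
(* This scaling turns the identity at [phi0] into [\sum_l P l = 1]. *)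
pose Dinv := diag_mx (\row_i (a i)^-1).
pose P l := b l *: N l *m Dinv.
have PE l i j : P l i j = b l * N l i j / a j.
  by rewrite /P mul_mx_diag !mxE.
have pencilP (phi : 'rV_p) : \sum_l ((phi *m gamma l) 0 0 / b l) *: P l =
    diag_mx (\row_i ((phi *m w i) 0 0 / a i)).
  transitivity ((\sum_l (phi *m gamma l) 0 0 *: N l) *m Dinv).
    rewrite mulmx_suml; apply: eq_bigr => l _.
    by rewrite /P -!scalemxAl scalerA divfK.
  rewrite pencil mulmx_diag; congr diag_mx.
  by apply/rowP => i; rewrite !mxE.
have sumP : \sum_l P l = 1%:M.
  have := pencilP phi0; rewrite (eq_bigr P) => [->|l _]; last first.
    by rewrite -/(b l) divff ?scale1r.
  rewrite -diag_const_mx; congr diag_mx.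
  by apply/rowP => i; rewrite [LHS]mxE [RHS]mxE divff ?a_neq0.
have rankP : (\sum_l \rank (P l) <= r)%N.
  apply: leq_trans rankN; apply: leq_sum => l _.
  exact: leq_trans (mxrankM_maxl _ _) (mxrank_scale _ _).
(* Multiply the pencil on the left by [P l]: orthogonality leaves only the term in [l], while the
   diagonal matrix scales column [j]. *)
have pencil_eigen (phi : 'rV_p) l i j :
    P l i j * ((phi *m w j) 0 0 / a j) = (phi *m gamma l) 0 0 / b l * P l i j.
  have := congr1 (mulmx (P l)) (pencilP phi).
  rewrite mulmx_sumr (bigD1 l) //= big1 => [|k kl]; last first.
    rewrite -scalemxAr (rank_additive_idem _ _ sumP rankP).
    by rewrite eq_sym (negPf kl) scaler0.
  rewrite addr0 -scalemxAr (rank_additive_idem _ _ sumP rankP) eqxx mul_mx_diag.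
  by move/matrixP/(_ i j); rewrite !mxE.
have P_support l i j : P l i j != 0 -> w j = (a j / b l) *: gamma l.
  move=> P_neq0; apply/colP => k; rewrite mxE.
  (* The covectors [delta_mx 0 k] read off coordinates, so the scalar identities give one between
     vectors. *)
  have rowk (x : 'cV[K]_p) : ((delta_mx 0 k : 'rV[K]_p) *m x) 0 0 = x k 0.
    by rewrite -rowE mxE.
  have := pencil_eigen (delta_mx 0 k) l i j; rewrite !rowk [RHS]mulrC.
  move/(mulfI P_neq0)/(congr1 (fun x => x * a j)); rewrite divfK // => ->.
  by rewrite mulrC mulrA mulrAC.
(* The diagonal entries of [\sum_l P l] are 1, so for each [i] some [P l] is nonzero at [(i, i)]. *)
have [c cP] : exists c : 'I_r -> 'I_q, forall i, P (c i) i i != 0.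
  apply: (fin_all_exists (P := fun i l => P l i i != 0)) => i.
  apply/existsP; apply: contraT => /existsPn P0.
  have /eqP := congr1 (fun A : 'M_r => A i i) sumP.
  rewrite summxE !mxE eqxx big1 1?eq_sym ?oner_eq0 // => l _.
  by apply/eqP; have := P0 l; rewrite negbK.
(* Otherwise [w j] would be a nonzero multiple of both [gamma l] and [gamma (c j)]. *)
have P0 l i j : c j != l -> P l i j = 0.
  move=> cjl; apply/eqP; apply: contraT => /P_support wl.
  case: (gamma_nc _ _ cjl); left.
  exists ((a j / b (c j))^-1 * (a j / b l)).
  rewrite -scalerA -wl (P_support _ _ _ (cP j)) scalerA mulVf ?scale1r //.
  by rewrite mulf_neq0 ?invr_eq0.
exists c; split=> [i|l]; first exact: P_support (cP i).
apply/matrixP => i j; rewrite !mxE.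
have -> : N l i j = P l i j * (a j / b l).
  by rewrite PE mulrA divfK // mulrC mulKf.
have [cjl|cjl] := eqVneq (c j) l; last first.
  rewrite P0 // mul0r; case: (eqVneq i j) => [->|_]; last by rewrite mulr0n.
  by rewrite (negPf cjl) mul0rn.
(* Only [P l] contributes to column [j] of [\sum_k P k = 1]. *)
have -> : P l i j = (i == j)%:R.
  have := congr1 (fun A : 'M_r => A i j) sumP.
  rewrite summxE (bigD1 l) //= big1 ?addr0 => [->|k kl]; first by rewrite mxE.
  by rewrite P0 // cjl eq_sym.
by case: (eqVneq i j) => [->|_]; rewrite ?mul0r // cjl eqxx mul1r.
Qed.

(** * From the model case to general families *)

Lemma free_row_free (K : fieldType) (m r : nat) (u : 'I_r -> 'cV[K]_m) :
  free [tuple u i | i < r] -> row_free (\matrix_(i, j) u i j 0).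
Proof.
move=> /freeP u_free; apply: inj_row_free => x xU0.
apply/rowP => i; rewrite mxE; apply: (u_free (fun i => x 0 i)).
apply/colP => j; move/rowP/(_ j): xU0; rewrite !mxE summxE => xU0j.
rewrite -[RHS]xU0j; apply: eq_bigr => k _; rewrite !mxE; congr (_ * _).
by rewrite -tnth_nth tnth_mktuple.
Qed.

Lemma memv_Im (K : fieldType) (m n : nat) (M : 'M[K]_(m, n)) (y : 'cV[K]_m) :
  reflect (exists x : 'cV_n, y = M *m x) (y \in Im M).
Proof.
apply: (iffP memv_imgP) => [[x _ ->]|[x ->]]; exists x; rewrite ?lfunE ?memvf //.
Qed.

Lemma colinear_sym (K : fieldType) (p : nat) (x y : 'cV[K]_p) :
  colinear x y -> colinear y x.
Proof. by case; [right | left]. Qed.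

Lemma colinear_trans (K : fieldType) (p : nat) (y x z : 'cV[K]_p) :
  y != 0 -> colinear x y -> colinear y z -> colinear x z.
Proof.
move=> y_neq0 [[a xy]|[a yx]] [[b yz]|[b zy]].
- by left; exists (a * b); rewrite xy yz scalerA.
- have [a0|a_neq0] := eqVneq a 0; first by left; exists 0; rewrite xy a0 !scale0r.
  by right; exists (b / a); rewrite zy xy scalerA divfK.
- have b_neq0 : b != 0 by apply: contra y_neq0 => /eqP b0; rewrite yz b0 scale0r.
  by right; exists (b^-1 * a); rewrite -scalerA -yx yz scalerA mulVf ?scale1r.
- by right; exists (b * a); rewrite zy yx scalerA.
Qed.

(** The first clause describes the fibres of [c] by [w] alone, so that two decompositions can be
    compared. *)
Lemma mv_decomposition_images (K : fieldType) (m n p r : nat) (T : tensor K m n p)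
    (u : 'I_r -> 'cV[K]_m) (v : 'I_r -> 'cV[K]_n) (w : 'I_r -> 'cV[K]_p)
    (q : nat) (M : 'I_q -> 'M[K]_(m, n)) (gamma : 'I_q -> 'cV[K]_p) :
  infinite_set [set: K]%classic ->
  T = \sum_(i < r) tensor3 (u i) (v i) (w i) ->
  free [tuple u i | i < r] -> free [tuple v i | i < r] ->
  (forall i, w i != 0) ->
  mv_decomposition T M gamma -> mv_rank M = r ->
  exists c : 'I_r -> 'I_q,
    [/\ forall i j, c i = c j <-> colinear (w i) (w j),
        forall l, exists i, c i = l
      & forall l, Im (M l) = (\sum_(i | c i == l) <[u i]>)%VS].
Proof.
move=> K_inf T_def /free_row_free u_free /free_row_free v_free w_neq0.
case=> T_M M_neq0 gamma_neq0 gamma_nc rankM.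
have [phi0 phi0w] := separating_covector K_inf w_neq0.
set U : 'M_(r, m) := \matrix_(i, j) _ in u_free.
set V : 'M_(r, n) := \matrix_(i, j) _ in v_free.
have [Ui UUi] := row_freeP u_free; have [Vi VVi] := row_freeP v_free.
have contractE (phi : 'rV_p) : \sum_l (phi *m gamma l) 0 0 *: M l =
    U^T *m diag_mx (\row_i (phi *m w i) 0 0) *m V.
  transitivity (contract phi T).
    by rewrite T_M contract_sum; apply: eq_bigr => l _; rewrite contract_mv.
  rewrite T_def contract_sum.
  under eq_bigr => i _ do rewrite tensor3_mv contract_mv.
  apply/matrixP => i j; rewrite summxE mul_mx_diag [RHS]mxE.
  apply: eq_bigr => k _; rewrite !mxE big_ord1 !mxE.
  by rewrite -mulrA mulrCA mulrA.
pose D0 := diag_mx (\row_i (phi0 *m w i) 0 0).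
(* The contraction factors through dimension [r], and one-sided inverses of [U^T] and [V] recover
   the invertible [D0] from it. *)
have rankA : \rank (\sum_l (phi0 *m gamma l) 0 0 *: M l)%R = r.
  apply/eqP; rewrite eqn_leq; apply/andP; split.
    rewrite contractE -mulmxA; exact: leq_trans (mxrankM_maxr _ _) (rank_leq_row _).
  have <- : \rank D0 = r.
    apply: mxrank_unit; rewrite unitmxE det_diag unitfE.
    by apply/prodf_neq0 => i _; rewrite mxE.
  have -> : D0 = Ui^T *m (\sum_l (phi0 *m gamma l) 0 0 *: M l) *m Vi.
    rewrite contractE -!mulmxA VVi mulmx1 mulmxA -trmx_mul UUi trmx1.
    by rewrite mul1mx.
  exact: leq_trans (mxrankM_maxl _ _) (mxrankM_maxr _ _).
have rankM_le : (\sum_l \rank (M l) <= r)%N by rewrite -[X in (_ <= X)%N]rankM.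
have b_neq0 l : (phi0 *m gamma l) 0 0 != 0.
  by apply: (rank_additive_coef_neq0 rankA).
have M_sub l : (M l <= V)%MS /\ ((M l)^T <= U)%MS.
  pose B k := (phi0 *m gamma k) 0 0 *: M k.
  have rankB : (\sum_k \rank (B k) <= r)%N.
    by apply: leq_trans rankM_le; apply: leq_sum => k _; apply: mxrank_scale.
  have trB : \sum_k (B k)^T = (\sum_k B k)^T by rewrite linear_sum.
  split; rewrite -(eqmx_scale _ (b_neq0 l)).
    apply: submx_trans (rank_additive_sub (B := B) l _) _; first by rewrite rankA.
    by rewrite contractE submxMl.
  rewrite -linearZ /=.
  apply: submx_trans (rank_additive_sub (B := fun k => (B k)^T) l _) _.
    rewrite trB mxrank_tr rankA; apply: leq_trans rankB.
    by apply: leq_sum => k _; rewrite mxrank_tr.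
  by rewrite trB contractE trmx_mul trmx_mul trmxK mulmxA submxMl.
(* These are the coordinates of [M l] in the families [u] and [v]; by [M_sub] nothing is lost. *)
pose N l := Ui^T *m M l *m Vi.
have M_N l : M l = U^T *m N l *m V.
  have [/submxP[X MX] /submxP[Y MY]] := M_sub l.
  have {}MX : M l = M l *m Vi *m V by rewrite MX -!mulmxA (mulmxA V) VVi mul1mx.
  rewrite /N -!mulmxA (mulmxA (M l)) -MX mulmxA -trmx_mul.
  by apply: trmx_inj; rewrite [RHS]trmx_mul trmxK MY -!mulmxA (mulmxA U) UUi mul1mx.
have pencil (phi : 'rV_p) : \sum_l (phi *m gamma l) 0 0 *: N l =
    diag_mx (\row_i (phi *m w i) 0 0).
  transitivity (Ui^T *m (\sum_l (phi *m gamma l) 0 0 *: M l) *m Vi).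
    rewrite mulmx_sumr mulmx_suml; apply: eq_bigr => l _.
    by rewrite -scalemxAr -scalemxAl.
  by rewrite contractE -!mulmxA VVi mulmx1 mulmxA -trmx_mul UUi trmx1 mul1mx.
have rankN : (\sum_l \rank (N l) <= r)%N.
  apply: leq_trans rankM_le; apply: leq_sum => l _.
  exact: leq_trans (mxrankM_maxl _ _) (mxrankM_maxr _ _).
have [c [wE NE]] := diagonal_pencil pencil rankN phi0w b_neq0 gamma_nc.
have w_col i : colinear (w i) (gamma (c i)) by left; eexists; exact: wE.
exists c; split=> [i j|l|l].
- split=> [cij|w_ij].
    apply: colinear_trans (w_col i) _ => //; rewrite cij.
    exact/colinear_sym/w_col.
  apply/eqP; apply: contraT => /gamma_nc; case.
  apply: (colinear_trans (w_neq0 i)); first exact/colinear_sym/w_col.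
  exact: colinear_trans w_ij (w_col j).
(* An [l] outside the image of [c] would give [N l = 0], hence [M l = 0]. *)
- have /existsP[i /eqP] : [exists i, c i == l]; last by exists i.
  apply: contraT => /existsPn cl; case/eqP: (M_neq0 l).
  rewrite M_N NE; set d := \row_i _; have -> : d = 0.
    by apply/rowP => i; rewrite !mxE (negPf (cl i)).
  by rewrite linear0 mulmx0 mul0mx.
have UrowE i : (row i U)^T = u i by apply/colP => j; rewrite !mxE.
move/(_ l): NE; set d := \row_i _ => NE.
apply/eqP; rewrite eqEsubv; apply/andP; split.
  apply/subvP => _ /memv_Im[x ->].
  rewrite M_N NE -!mulmxA -[_ *m _]trmxK trmx_mul trmxK mulmx_sum_row linear_sum.
  apply: memv_suml => i _; rewrite linearZ /= UrowE.
  have [cil|cil] := boolP (c i == l).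
    by apply: (subvP (sumv_sup i cil (subvv _))); rewrite memvZ ?memv_line.
  by rewrite mul_diag_mx !mxE (negPf cil) mul0r scale0r mem0v.
apply/subv_sumP => i cil; rewrite -memvE; apply/memv_Im.
(* [V] sends column [i] of [Vi] to a basis vector, which [diag_mx d] scales by [d 0 i] and [U^T]
   then sends to [u i]. *)
exists (Vi *m ((d 0 i)^-1 *: delta_mx i 0)).
rewrite M_N NE -!mulmxA (mulmxA V) VVi mul1mx -!scalemxAr.
have -> : diag_mx d *m delta_mx i 0 = d 0 i *: delta_mx i (0 : 'I_1).
  apply/colP => j; rewrite mul_diag_mx !mxE.
  by case: (eqVneq j i) => [->|_] //; rewrite !mulr0.
rewrite -scalemxAr scalerA mulVf ?scale1r -?colE -?tr_row ?UrowE //.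
by rewrite mxE cil mulf_neq0 ?invr_eq0.
Qed.

Theorem theorem3p11 (K : fieldType)
    (K_infinite : infinite_set [set: K]%classic)
    (m n p r : nat) (T : tensor K m n p)
    (u : 'I_r -> 'cV[K]_m) (v : 'I_r -> 'cV[K]_n) (w : 'I_r -> 'cV[K]_p)
    (T_def : T = \sum_(i < r) tensor3 (u i) (v i) (w i))
    (u_free : free [tuple u i | i < r])
    (v_free : free [tuple v i | i < r])
    (w_neq0 : forall i, w i != 0)
    (q q' : nat)
    (M : 'I_q -> 'M[K]_(m, n)) (gamma : 'I_q -> 'cV[K]_p)
    (M' : 'I_q' -> 'M[K]_(m, n)) (gamma' : 'I_q' -> 'cV[K]_p)
    (decM : mv_decomposition T M gamma) (rankM : mv_rank M = r)
    (decM' : mv_decomposition T M' gamma') (rankM' : mv_rank M' = r) :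
  exists (eq_q : q = q') (pi : 'S_q),
    forall l : 'I_q, Im (M' (cast_ord eq_q l)) = Im (M (pi l)).
Proof.
have [c [c_col c_surj ImM]] :=
  mv_decomposition_images K_infinite T_def u_free v_free w_neq0 decM rankM.
have [c' [c'_col c'_surj ImM']] :=
  mv_decomposition_images K_infinite T_def u_free v_free w_neq0 decM' rankM'.
(* [s] and [s'] choose representatives of the classes. As [c] and [c'] have the same fibres, passing
   between their indices through a representative is bijective. *)
have [s sK] := fin_all_exists c_surj.
have [s' s'K] := fin_all_exists c'_surj.
have cc' i j : c i = c j <-> c' i = c' j by rewrite c_col c'_col.
pose f l := c' (s l); pose g l := c (s' l).
have fK : cancel f g by move=> l; rewrite -[RHS]sK; apply/cc'; exact: s'K.
have gK : cancel g f by move=> l; rewrite -[RHS]s'K; apply/cc'; exact: sK.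
have eq_q : q = q'.
  by have /bij_eq_card := Bijective fK gK; rewrite !card_ord.
have g_inj : injective (fun l => g (cast_ord eq_q l)).
  exact: inj_comp (can_inj gK) (@cast_ord_inj _ _ eq_q).
exists eq_q, (perm g_inj) => l; rewrite permE ImM ImM'.
apply: eq_bigl => i; apply/eqP/eqP => [c'i|ci].
  by apply/cc'; rewrite s'K.
by rewrite -[RHS]s'K; apply/cc'.
Qed.
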